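(* Let $(u_i,v_i,\omega_i)$, $i=1,2$, be two solutions on $[0,T]$, with the same data, of the boundary layer problem described in the context, in the class described there. Set $\bar u:=u_1-u_2$, $\bar\omega:=\omega_1-\omega_2$, $a_2:=\partial_y\omega_2/\omega_2$, and $$\bar g:=\bar\omega-a_2\bar u=\omega_2\,\partial_y\Bigl(\frac{\bar u}{\omega_2}\Bigr).$$ Then there exists a constant $C_{\sigma,\delta}$, depending only on $\sigma$ and $\delta$, such that (at each time $t\in[0,T]$) $$\Bigl\|\frac{\bar u}{1+y}\Bigr\|_{L^2(\Omega)}+\|\bar\omega\|_{L^2(\Omega)}\le C_{\sigma,\delta}\|\bar g\|_{L^2(\Omega)}.$$
   Context: $\Omega:=\mathbb T\times\mathbb R_+$ with variables $(x,y)$; for $\alpha=(\alpha_1,\alpha_2)$, $D^\alpha=\partial_x^{\alpha_1}\partial_y^{\alpha_2}$. Parameters: $1<n<\frac73$, $s\ge6$ an even integer, $\gamma\ge1$, $\gamma+\frac12<\sigma\le\min\{\frac2{n-1},\gamma+\frac43\}$, $\delta\in(0,\frac12)$. Boundary layer problem, on $[0,T]\times\mathbb T\times\mathbb R_+$: $\partial_tu+u\partial_xu+v\partial_yu-n(\partial_yu)^{n-1}\partial_y^2u+\partial_xp=0$, $\partial_xu+\partial_yv=0$, $u|_{t=0}=u_0$, $u|_{y=0}=v|_{y=0}=0$, $u|_{y\to+\infty}=U$, where $(U,p)(t,x)$ is given, periodic in $x$, with $\partial_tU+U\partial_xU+\partial_xp=0$, and $\omega:=\partial_yu$. Solution class: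 classical solutions with $u_i-U\in L^\infty([0,T];H^{s,\gamma-1})$ and $\omega_i=\partial_yu_i\in L^\infty([0,T];H^{s,\gamma}_{\sigma,\delta})$, where $\|\omega\|_{H^{s,\gamma}}^2:=\sum_{|\alpha|\le s}\|(1+y)^{\gamma+\alpha_2}D^\alpha\omega\|_{L^2(\Omega)}^2$, $H^{s,\gamma}$ is the space where this is finite, and $H^{s,\gamma}_{\sigma,\delta}:=\{\omega\in H^{s,\gamma}:(1+y)^\sigma\omega\ge\delta,\ \sum_{|\alpha|\le2}|(1+y)^{\sigma+\alpha_2}D^\alpha\omega|^2\le\delta^{-2}\}$. ''Same data'' means same $u_0$, $U$, $p$. *)

(* Defs.v *)
From HB Require Import structures.
From mathcomp Require Import all_boot all_order all_algebra.
From mathcomp Require Import all_classical all_reals all_analysis.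

Set Implicit Arguments.
Unset Strict Implicit.
Unset Printing Implicit Defensive.

Import Order.TTheory GRing.Theory Num.Theory.
Import numFieldNormedType.Exports.

Local Open Scope classical_set_scope.
Local Open Scope ring_scope.

(* Points of the half-plane are pairs z = (x, y).  The torus T is R / Z: a
   function on T x R_+ is a function on R * R that is 1-periodic in x (its
   values for y < 0 are never used), and integrals are taken over the
   fundamental domain [0, 1[ of T.  Time-dependent functions are
   u : R -> R * R -> R, so that [u t] is the spatial slice at time t. *)

Section Space.
Context {R : realType}.
Implicit Types (f g phi : R * R -> R) (z : R * R).

Definition periodic_x f :=
  forall z, 0 <= z.2 -> f (z.1 + 1, z.2) = f z.

Definition Omega : set (R * R) := [set z | 0 <= z.1 < 1 /\ 0 < z.2].

Definition leb2 := (@lebesgue_measure R \x @lebesgue_measure R)%E.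

Definition L2norm f : \bar R := ('N[leb2]_(2%:E)[EFin \o (f \_ Omega)])%E.

Definition weight (r : R) z : R := (1 + z.2) `^ r.

Definition e_x : R * R := (1, 0).
Definition e_y : R * R := (0, 1).
Definition dx f : R * R -> R := fun z => 'D_(e_x) f z.
Definition dy f : R * R -> R := fun z => 'D_(e_y) f z.
Definition Dab (a b : nat) f : R * R -> R := iter a dx (iter b dy f).

Fixpoint Ck (k : nat) f : Prop :=
  continuous f /\
  if k is k'.+1 then
    [/\ forall z, derivable f z e_x /\ derivable f z e_y,
        Ck k' (dx f) & Ck k' (dy f)]
  else True.

(* C_c^infinity(T x (0, +oo)) *)
Definition test_function phi :=
  [/\ forall k, Ck k phi,
      forall z, phi (z.1 + 1, z.2) = phi z &
      exists c d : R, [/\ 0 < c, c < d &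
        forall z, ~~ (c <= z.2 <= d) -> phi z = 0]].

Definition locally_L1 f := forall c d : R, 0 < c -> c < d ->
  leb2.-integrable [set z | 0 <= z.1 < 1 /\ c <= z.2 <= d] (EFin \o f).

Definition is_weak_derivative (a b : nat) f g :=
  [/\ locally_L1 f, locally_L1 g &
    forall phi, test_function phi ->
      Rintegral leb2 Omega (fun z => f z * Dab a b phi z) =
      (-1) ^+ (a + b) * Rintegral leb2 Omega (fun z => g z * phi z)].

Definition weakD (a b : nat) f : R * R -> R :=
  get [set g | is_weak_derivative a b f g].

Definition Hnorm_sq (s : nat) (gamma : R) f : \bar R :=
  (\sum_(a < s.+1) \sum_(b < s.+1 | (a + b <= s)%N)
     L2norm (fun z => weight (gamma + b%:R) z * weakD a b f z)%R ^+ 2)%E.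

Definition Hspace (s : nat) (gamma : R) : set (R * R -> R) :=
  [set f | (forall a b, (a + b <= s)%N ->
              exists g, is_weak_derivative a b f g) /\
           (Hnorm_sq s gamma f < +oo)%E].

(* The pointwise constraints use classical derivatives: for s >= 6 they exist
   for the continuous representative, by Sobolev embedding. *)
Definition Hspace_sd (s : nat) (gamma sigma delta : R) : set (R * R -> R) :=
  [set f | [/\ Hspace s gamma f,
    forall z, 0 < z.2 -> delta <= weight sigma z * f z &
    forall z, 0 < z.2 ->
      \sum_(a < 3) \sum_(b < 3 | (a + b <= 2)%N)
        `|weight (sigma + b%:R) z * Dab a b f z| ^+ 2 <= delta ^- 2]].

(* L^oo([0, T]; X) for X a subset of H^{s,gamma}: Bochner measurable (almost
   everywhere limit of simple functions) and essentially bounded. *)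
Definition Hstrongly_measurable (T : R) (s : nat) (gamma : R)
    (F : R -> R * R -> R) :=
  exists S : nat -> R -> R * R -> R,
    [/\ forall k, finite_set (range (S k)),
        forall k h, measurable (S k @^-1` [set h]),
        forall k t, Hspace s gamma (S k t) &
        {ae @lebesgue_measure R, forall t, 0 <= t <= T ->
           Hnorm_sq s gamma (fun z => F t z - S k t z)
             @[k --> \oo] --> (0 : \bar R)%E}].

Definition Linfty_H (T : R) (s : nat) (gamma : R) (X : set (R * R -> R))
    (F : R -> R * R -> R) :=
  Hstrongly_measurable T s gamma F /\
  exists M : R, {ae @lebesgue_measure R, forall t, 0 <= t <= T ->
    X (F t) /\ (Hnorm_sq s gamma (F t) <= M%:E)%E}.

End Space.

Section BoundaryLayer.
Context {R : realType}.
Implicit Types (T n : R) (U p : R -> R -> R)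
  (u v : R -> R * R -> R).

Record outer_flow T U p : Prop := {
  outer_U_periodic : forall t x, 0 <= t <= T -> U t (x + 1) = U t x;
  outer_p_periodic : forall t x, 0 <= t <= T -> p t (x + 1) = p t x;
  outer_derivable : forall t x, 0 < t < T ->
    [/\ derivable (U ^~ x) t 1, derivable (U t) x 1 & derivable (p t) x 1];
  outer_bernoulli : forall t x, 0 < t < T ->
    derive1 (U ^~ x) t + U t x * derive1 (U t) x + derive1 (p t) x = 0 }.

Definition closed_cyl T : set (R * (R * R)) :=
  [set q | 0 <= q.1 <= T /\ 0 <= q.2.2].
Definition cyl_off_wall T : set (R * (R * R)) :=
  [set q | 0 <= q.1 <= T /\ 0 < q.2.2].
Definition interior_cyl T : set (R * (R * R)) :=
  [set q | 0 < q.1 < T /\ 0 < q.2.2].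

Definition continuous_on (A : set (R * (R * R))) (w : R -> R * R -> R) :=
  {within A, continuous (fun q : R * (R * R) => w q.1 q.2)}.

Definition dt u : R -> R * R -> R := fun t z => derive1 (u ^~ z) t.

Record classical_solution T n U p (u0 : R * R -> R) u v : Prop := {
  sol_periodic : forall t, 0 <= t <= T -> periodic_x (u t) /\ periodic_x (v t);
  sol_continuous : continuous_on (closed_cyl T) u /\
                   continuous_on (closed_cyl T) v;
  sol_derivable_space : forall t z, 0 <= t <= T -> 0 < z.2 ->
    [/\ derivable (u t) z e_x, derivable (u t) z e_y,
        derivable (dy (u t)) z e_y & derivable (v t) z e_y];
  sol_derivable_time : forall t z, 0 < t < T -> 0 < z.2 ->
    derivable (u ^~ z) t 1;
  sol_continuous_derivatives :
    [/\ continuous_on (cyl_off_wall T) (fun t => dx (u t)),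
        continuous_on (cyl_off_wall T) (fun t => dy (u t)),
        continuous_on (cyl_off_wall T) (fun t => dy (dy (u t))) &
        continuous_on (interior_cyl T) (dt u)];
  sol_momentum : forall t z, 0 < t < T -> 0 < z.2 ->
    dt u t z + u t z * dx (u t) z + v t z * dy (u t) z
      - n * (dy (u t) z) `^ (n - 1) * dy (dy (u t)) z + derive1 (p t) z.1 = 0;
  sol_incompressible : forall t z, 0 <= t <= T -> 0 < z.2 ->
    dx (u t) z + dy (v t) z = 0;
  sol_initial : forall z, 0 <= z.2 -> u 0 z = u0 z;
  sol_wall : forall t x, 0 <= t <= T -> u t (x, 0) = 0 /\ v t (x, 0) = 0;
  sol_far_field : forall t x, 0 <= t <= T ->
    u t (x, y) @[y --> +oo] --> U t x }.

Definition solution_class T (s : nat) (gamma sigma delta : R) U u : Prop :=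
  Linfty_H T s (gamma - 1) (Hspace s (gamma - 1)) (fun t z => u t z - U t z.1) /\
  Linfty_H T s gamma (Hspace_sd s gamma sigma delta) (fun t => dy (u t)).

End BoundaryLayer.

(* Main.v *)
Require Import Defs.
From HB Require Import structures.
From mathcomp Require Import all_boot all_order all_algebra.
From mathcomp Require Import all_classical all_reals all_analysis.
From mathcomp Require Import measurable_realfun lra ring.

Set Implicit Arguments.
Unset Strict Implicit.
Unset Printing Implicit Defensive.

Import Order.TTheory GRing.Theory Num.Theory.
Import numFieldNormedType.Exports.

Local Open Scope classical_set_scope.
Local Open Scope ring_scope.

(* On each line x = const the quotient f = ubar / omega_2 vanishes at y = 0 and
   has derivative gbar / omega_2, while omega_2 is comparable to
   (1 + y)^-sigma.  Integrating the derivative of (1 + y)^(-2 sigma - 1) f^2 and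
   completing a square gives Hardy's inequality
   || (1 + y)^(-sigma - 1) f || <= || (1 + y)^-sigma f' ||; the boundary term at
   infinity has a favourable sign, so no decay of ubar is required.  This bounds
   ubar / (1 + y) by gbar, and omegabar = gbar + a_2 ubar with
   |a_2| <= delta^-2 / (1 + y) bounds omegabar. *)

Section Continuity.
Context {R : realType}.

Lemma within_cvg_comp (X Y : topologicalType) (S : Type) (G : set_system S)
    {FG : Filter G} (A : set X) (F : X -> Y) (h : S -> X) (q : X) :
  {within A, continuous F} -> A q -> h s @[s --> G] --> q ->
  (\forall s \near G, A (h s)) -> F (h s) @[s --> G] --> F q.
Proof.
move=> /subspace_continuousP cF Aq hq GA.
apply: (cvg_comp _ _ _ (cF q Aq)) => P /hq.
by apply: filterS2 GA => s As; exact.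
Qed.

Lemma half_plane_open : open [set z : R * R | 0 < z.2].
Proof.
have -> : [set z : R * R | 0 < z.2] = snd @^-1` [set y : R | 0 < y] by [].
apply: open_comp; last exact: open_gt.
by move=> z _; exact: cvg_snd.
Qed.

Lemma open_measurable_prod (O : set (R * R)) : open O ->
  @measurable _ (R * R)%type O.
Proof.
move=> oO.
pose B (q : (rat * rat) * (rat * rat)) : set (R * R) :=
  `]ratr q.1.1, ratr q.1.2[%classic `*` `]ratr q.2.1, ratr q.2.2[%classic.
have -> : O = \bigcup_q (if pselect (B q `<=` O) then B q else set0).
  apply/seteqP; split => [z Oz|z [q _]]; last by case: pselect => [BO /BO|].
  move: oO; rewrite openE => /(_ _ Oz) /nbhs_ballP[e /= e0 zeO].
  have rat_near (x : R) : exists q : rat * rat,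
      [/\ x - e < ratr q.1, ratr q.1 < x, x < ratr q.2 & ratr q.2 < x + e].
    have xe : x - e < x by lra.
    have ex : x < x + e by lra.
    have [a] := rat_in_itvoo xe; have [b] := rat_in_itvoo ex.
    rewrite !in_itv/= => /andP[? ?] /andP[? ?].
    by exists (a, b).
  have [q1 [q11 q12 q13 q14]] := rat_near z.1.
  have [q2 [q21 q22 q23 q24]] := rat_near z.2.
  exists (q1, q2) => //; case: pselect => [BO|]; last first.
    case=> w [/= w1 w2]; apply: zeO.
    move: w1 w2; rewrite !in_itv/= => /andP[? ?] /andP[? ?].
    by split; rewrite /ball/= ltr_distlC; apply/andP; split; lra.
  by split; rewrite /= in_itv/=; apply/andP.
apply: countable_bigcupT_measurable => [|q]; first exact: countableP.
case: pselect => BO /=; last exact: measurable0.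
by apply: measurableX.
Qed.

End Continuity.

Section Measurability.
Context {R : realType}.

Lemma open_continuous_measurable_prod (D : set (R * R)) (f : R * R -> R) :
  open D -> {in D, continuous f} ->
  @measurable_fun _ _ (R * R)%type R D f.
Proof.
move=> oD; rewrite -(continuous_open_subspace f oD) => /continuousP cf.
apply: (measurability _ (RGenOpens.measurableE R)) => _ [_ [a [b ->]] <-].
apply: open_measurable_prod; rewrite open_setSI//.
exact/cf/interval_open.
Qed.

Lemma Omega_measurable : @measurable _ (R * R)%type (@Omega R).
Proof.
have -> : @Omega R = `[0, 1[%classic `*` `]0, +oo[%classic.
  by apply/seteqP; split => -[x y] [/=]; rewrite !in_itv/= andbT.
by apply: measurableX.
Qed.

Lemma L2normE (f : R * R -> R) :
  L2norm f = ((\int[leb2]_(z in Omega) (f z ^+ 2)%:E) `^ 2^-1)%E.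
Proof.
rewrite /L2norm unlock; congr (_ `^ _)%E.
rewrite [RHS]integral_mkcond; apply: eq_integral => z _ /=.
rewrite powR_mulrn// real_normK ?num_real// !patchE.
by case: ifP => // _; rewrite expr0n.
Qed.

Lemma ge0_Omega_integral (f : R * R -> R) :
  (0 <= \int[leb2]_(z in Omega) (f z ^+ 2)%:E)%E.
Proof. by apply: integral_ge0 => z _; rewrite lee_fin sqr_ge0. Qed.

Lemma L2norm_le (c : R) (f g : R * R -> R) : 0 <= c ->
  (\int[leb2]_(z in Omega) (f z ^+ 2)%:E <=
   (c ^+ 2)%:E * \int[leb2]_(z in Omega) (g z ^+ 2)%:E)%E ->
  (L2norm f <= c%:E * L2norm g)%E.
Proof.
move=> c0 fg; rewrite !L2normE.
have -> : c%:E = ((c ^+ 2)%:E `^ 2^-1)%E.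
  by rewrite poweR_EFin -powR_mulrn// -powRrM divff// powRr1.
rewrite -poweRM ?lee_fin ?sqr_ge0 ?ge0_Omega_integral//.
apply: gt0_ler_poweR; rewrite ?invr_ge0// in_itv/= leey andbT.
  exact: ge0_Omega_integral.
by rewrite mule_ge0 ?lee_fin ?sqr_ge0 ?ge0_Omega_integral.
Qed.

Lemma measurable_sqr_Omega (f : R * R -> R) :
  @measurable_fun _ _ (R * R)%type R Omega f ->
  @measurable_fun _ _ (R * R)%type (\bar R) Omega (fun z => (f z ^+ 2)%:E).
Proof. by move=> mf; apply/measurable_EFinP; exact: measurable_funX. Qed.

Lemma L2norm_le_pointwise (c : R) (f g : R * R -> R) : 0 <= c ->
  @measurable_fun _ _ (R * R)%type R Omega f ->
  @measurable_fun _ _ (R * R)%type R Omega g ->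
  (forall z, Omega z -> `|f z| <= c * `|g z|) ->
  (L2norm f <= c%:E * L2norm g)%E.
Proof.
move=> c0 mf mg fg; apply: L2norm_le => //.
rewrite -ge0_integralZl_EFin ?sqr_ge0//; last 3 first.
- exact: Omega_measurable.
- by move=> z _; rewrite lee_fin sqr_ge0.
- exact: measurable_sqr_Omega.
apply: ge0_le_integral.
- exact: Omega_measurable.
- by move=> z _; rewrite lee_fin sqr_ge0.
- exact: measurable_sqr_Omega.
- by apply: measurable_funeM; exact: measurable_sqr_Omega.
move=> z Oz; rewrite -EFinM lee_fin -[leLHS]real_normK ?num_real//.
rewrite -[g z ^+ 2]real_normK ?num_real// -exprMn.
by rewrite lerXn2r ?nnegrE ?mulr_ge0 ?fg.
Qed.

Lemma L2norm_le_sections (c : R) (f g : R * R -> R) : 0 <= c ->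
  @measurable_fun _ _ (R * R)%type R Omega f ->
  @measurable_fun _ _ (R * R)%type R Omega g ->
  (forall x, (\int[lebesgue_measure]_(y in `]0%R, +oo[) (f (x, y) ^+ 2)%:E <=
    (c ^+ 2)%:E * \int[lebesgue_measure]_(y in `]0%R, +oo[) (g (x, y) ^+ 2)%:E)%E) ->
  (L2norm f <= c%:E * L2norm g)%E.
Proof.
move=> c0 mf mg fg; apply: L2norm_le => //.
pose sq (h : R * R -> R) := (fun z => (h z ^+ 2)%:E) \_ Omega.
have msq (h : R * R -> R) : @measurable_fun _ _ (R * R)%type R Omega h ->
    @measurable_fun _ _ (R * R)%type (\bar R) setT (sq h).
  move=> mh; apply/(measurable_restrictT _ _).1; first exact: Omega_measurable.
  exact: measurable_sqr_Omega.
have sq0 h z : (0 <= sq h z)%E.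
  by apply: erestrict_ge0 => {}z _; rewrite lee_fin sqr_ge0.
have sectionE (h : R * R -> R) x : fubini_F lebesgue_measure (sq h) x =
    if x \in `[0, 1[%classic then
      (\int[lebesgue_measure]_(y in `]0%R, +oo[) (h (x, y) ^+ 2)%:E)%E else 0%E.
  rewrite /fubini_F /sq; case: ifPn => x01; last first.
    apply: integral0_eq => y _; rewrite patchE ifF//.
    by apply/negbTE; apply: contra x01; rewrite !inE/= in_itv/= => -[].
  rewrite [RHS]integral_mkcond; apply: eq_integral => y _.
  rewrite !patchE; move: x01; rewrite !inE/= in_itv/= => x01.
  case: ifPn => y0.
    by rewrite ifT// inE/= in_itv/= andbT; move: y0; rewrite inE => -[].
  rewrite ifF//; apply/negbTE; apply: contra y0.
  by rewrite !inE/= in_itv/= andbT.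
have mF h : @measurable_fun _ _ (R * R)%type R Omega h ->
    measurable_fun [set: R] (fubini_F lebesgue_measure (sq h)).
  by move=> mh; apply: measurable_fun_fubini_tonelli_F => //; exact: msq.
have F0 h x : (0 <= fubini_F lebesgue_measure (sq h) x)%E by exact: integral_ge0.
have tonelliE h : @measurable_fun _ _ (R * R)%type R Omega h ->
    (\int[leb2]_(z in Omega) (h z ^+ 2)%:E =
     \int[lebesgue_measure]_x fubini_F lebesgue_measure (sq h) x)%E.
  move=> mh; transitivity (\int[leb2]_z sq h z)%E; first by rewrite integral_mkcond.
  by apply: fubini_tonelli1 => //; exact: msq.
rewrite tonelliE// tonelliE// -ge0_integralZl_EFin ?sqr_ge0//; last exact: mF.
apply: ge0_le_integral => //; first exact: mF.
  by apply: measurable_funeM; exact: mF.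
by move=> x _; rewrite !sectionE; case: ifP => // _; rewrite mule0.
Qed.

Lemma L2normD (f g : R * R -> R) :
  @measurable_fun _ _ (R * R)%type R Omega f ->
  @measurable_fun _ _ (R * R)%type R Omega g ->
  (L2norm (fun z => f z + g z)%R <= L2norm f + L2norm g)%E.
Proof.
move=> mf mg; rewrite /L2norm.
have -> : (fun z => f z + g z) \_ Omega = f \_ Omega \+ g \_ Omega.
  by apply/funext => z; rewrite /= !patchE; case: ifP => // _; rewrite addr0.
have mr (h : R * R -> R) : @measurable_fun _ _ (R * R)%type R Omega h ->
    @measurable_fun _ _ (R * R)%type R setT (h \_ Omega).
  by apply: (measurable_restrictT _ _).1; exact: Omega_measurable.
by apply: minkowski_EFin; rewrite ?ler1n//; exact: mr.
Qed.

End Measurability.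

Section Hardy.
Context {R : realType}.
Local Notation mu := (@lebesgue_measure R).

Lemma is_derive_powR_add1 (a y : R) : 0 < y ->
  is_derive y 1 (fun y : R => (1 + y) `^ a) (a * (1 + y) `^ (a - 1)).
Proof.
move=> y0; have y10 : 0 < 1 + y by lra.
have d1 : is_derive y 1 (fun y : R => 1 + y) 1.
  by rewrite -[X in is_derive _ _ _ X]add0r; exact: is_deriveD.
rewrite -[X in is_derive _ _ _ X]mulr1.
exact: (@is_derive1_comp _ (fun x : R => x `^ a) (fun y : R => 1 + y) y _ _
  (@is_derive1_powR _ _ _ y10) d1).
Qed.

Lemma is_derive1_continuous (f : R -> R) (y d : R) :
  is_derive y 1 f d -> {for y, continuous f}.
Proof. by case=> df _; apply/differentiable_continuous/derivable1_diffP. Qed.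

Section Weights.
Variables (r : R) (f f' : R -> R).
Hypothesis r_ge : 2^-1 <= r.
Hypothesis df : forall y : R, 0 < y -> is_derive y 1 f (f' y).
Hypothesis cf' : forall y : R, 0 < y -> {for y, continuous f'}.

Let P (y : R) := (1 + y) `^ (- (r + 1)).
Let G y := (1 + y) `^ (- (2 * r + 1)) * f y ^+ 2.
Let G' y := P y ^+ 2 * (2 * (1 + y) * (f y * f' y) - (2 * r + 1) * f y ^+ 2).

Let is_derive_G (y : R) : 0 < y -> is_derive y 1 G (G' y).
Proof.
move=> y0; have y10 : 0 < 1 + y by lra.
have wE : (1 + y) `^ (- (2 * r + 1)) = (1 + y) * P y ^+ 2.
  rewrite /P -powR_mulrn ?powR_ge0// -powRrM.
  rewrite -[X in _ = X * _](powRr1 (ltW y10)).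
  by rewrite -powRD ?(gt_eqF y10) ?implybT//; congr (_ `^ _); lra.
have w'E : (1 + y) `^ (- (2 * r + 1) - 1) = P y ^+ 2.
  by rewrite /P -powR_mulrn ?powR_ge0// -powRrM; congr (_ `^ _); lra.
have dw := is_derive_powR_add1 (- (2 * r + 1)) y0.
have dG := is_deriveM dw (is_deriveM (df y0) (df y0)).
have -> : G = (fun y => (1 + y) `^ (- (2 * r + 1))) * (f * f) by [].
by apply: is_derive_eq; rewrite wE w'E /G' !fctE /GRing.scale/=; ring.
Qed.

Let pointwise (y : R) : 0 < y ->
  (P y * f y) ^+ 2 + G' y <= ((1 + y) `^ (- r) * f' y) ^+ 2.
Proof.
move=> y0; have y10 : 0 < 1 + y by lra.
have -> : (1 + y) `^ (- r) = (1 + y) * P y.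
  rewrite /P -[X in _ = X * _](powRr1 (ltW y10)).
  by rewrite -powRD ?(gt_eqF y10) ?implybT//; congr (_ `^ _); lra.
rewrite -subr_ge0 /G'.
have -> : ((1 + y) * P y * f' y) ^+ 2 - ((P y * f y) ^+ 2 +
    P y ^+ 2 * (2 * (1 + y) * (f y * f' y) - (2 * r + 1) * f y ^+ 2)) =
  P y ^+ 2 * (((1 + y) * f' y - f y) ^+ 2 + (2 * r - 1) * f y ^+ 2) by ring.
have r10 : 0 <= 2 * r - 1 by move: r_ge; lra.
by rewrite mulr_ge0 ?addr_ge0 ?sqr_ge0 ?(mulr_ge0 r10) ?sqr_ge0.
Qed.

Let cvgf (y : R) : 0 < y -> {for y, continuous f}.
Proof. by move=> /df /is_derive1_continuous. Qed.

Let cvgP (a y : R) : 0 < y -> {for y, continuous (fun y : R => (1 + y) `^ a)}.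
Proof. by move=> /(is_derive_powR_add1 a) /is_derive1_continuous. Qed.

Let cvgG' (y : R) : 0 < y -> {for y, continuous G'}.
Proof.
move=> y0; apply: cvgM.
  by apply: cvgM; exact: cvgP.
apply: cvgB; apply: cvgM.
- by apply: cvgM; [exact: cvg_cst|apply: cvgD; [exact: cvg_cst|exact: cvg_id]].
- by apply: cvgM; [exact: cvgf|exact: cf'].
- exact: cvg_cst.
- by apply: cvgM; exact: cvgf.
Qed.

Let within_itv (h : R -> R) (a b : R) : 0 < a ->
  (forall y, 0 < y -> {for y, continuous h}) -> {within `[a, b], continuous h}.
Proof.
move=> a0 ch; apply/continuous_in_subspaceT => y.
by rewrite inE/= in_itv/= => /andP[ay _]; apply: ch; exact: lt_le_trans ay.
Qed.

Let integrable_itv (h : R -> R) (a b : R) : 0 < a ->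
  (forall y, 0 < y -> {for y, continuous h}) -> mu.-integrable `[a, b] (EFin \o h).
Proof.
move=> a0 ch; apply: continuous_compact_integrable; first exact: segment_compact.
exact: within_itv.
Qed.

Let cvgp (y : R) : 0 < y -> {for y, continuous (fun y : R => (P y * f y) ^+ 2)}.
Proof.
move=> y0; apply: cvgM; apply: cvgM; by [exact: cvgP|exact: cvgf].
Qed.

Let cvgq (y : R) : 0 < y ->
  {for y, continuous (fun y : R => ((1 + y) `^ (- r) * f' y) ^+ 2)}.
Proof.
move=> y0; apply: cvgM; apply: cvgM; by [exact: cvgP|exact: cf'].
Qed.

Let segment (a b : R) : 0 < a -> a < b ->
  (\int[mu]_(y in `[a, b]) ((P y * f y) ^+ 2)%:E <=
   (f a ^+ 2)%:E + \int[mu]_(y in `[a, b]) (((1 + y) `^ (- r) * f' y) ^+ 2)%:E)%E.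
Proof.
move=> a0 ab; have b0 : 0 < b by lra.
have FTC : (\int[mu]_(y in `[a, b]) (G' y)%:E = (G b)%:E - (G a)%:E)%E.
  apply: continuous_FTC2 => //.
  - exact: within_itv.
  - split.
    + move=> y; rewrite in_itv/= => /andP[ay _].
      by have [] := is_derive_G (lt_trans a0 ay).
    + apply: cvg_at_right_filter; exact: is_derive1_continuous (is_derive_G a0).
    + apply: cvg_at_left_filter; exact: is_derive1_continuous (is_derive_G b0).
  - move=> y; rewrite in_itv/= => /andP[ay _]; rewrite derive1E.
    by have [_ ->] := is_derive_G (lt_trans a0 ay).
have : (\int[mu]_(y in `[a, b]) ((P y * f y) ^+ 2)%:E +
    \int[mu]_(y in `[a, b]) (G' y)%:E <=
    \int[mu]_(y in `[a, b]) (((1 + y) `^ (- r) * f' y) ^+ 2)%:E)%E.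
  rewrite -integralD_EFin//; [|exact: integrable_itv|exact: integrable_itv].
  apply: le_integral => //.
  - by apply: integrableD => //; exact: integrable_itv.
  - exact: integrable_itv.
  - move=> y; rewrite inE/= in_itv/= => /andP[ay _].
    by rewrite -EFinD lee_fin pointwise// (lt_le_trans a0).
rewrite FTC -EFinB => H.
rewrite -leeBlDl//; apply: le_trans H; rewrite -EFinN; apply: leeD2l.
rewrite lee_fin lerNl opprB.
have Gb0 : 0 <= G b by rewrite mulr_ge0 ?powR_ge0 ?sqr_ge0.
suff : G a <= f a ^+ 2 by lra.
rewrite /G -[leRHS]mul1r ler_wpM2r ?sqr_ge0//.
have a1 : 1 <= 1 + a by lra.
by rewrite -[leRHS](powRr0 (1 + a)) ler_powR//; move: r_ge; lra.
Qed.

Lemma hardy : f y @[y --> 0^'+] --> 0 ->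
  (\int[mu]_(y in `]0%R, +oo[) (((1 + y) `^ (- (r + 1)) * f y) ^+ 2)%:E <=
   \int[mu]_(y in `]0%R, +oo[) (((1 + y) `^ (- r) * f' y) ^+ 2)%:E)%E.
Proof.
move=> f0.
have meas (h : R -> R) : (forall y, 0 < y -> {for y, continuous h}) ->
    measurable_fun (`]0%R, +oo[%classic : set R) (EFin \o h).
  move=> ch; apply/measurable_EFinP.
  apply: open_continuous_measurable_fun; first exact: interval_open.
  by move=> y; rewrite inE/= in_itv/= andbT => y0; exact: ch.
pose S (n : nat) : set R := `[n.+1%:R^-1, n.+2%:R]%classic.
have S_pos n : S n `<=` `]0%R, +oo[%classic.
  move=> y; rewrite /S/= !in_itv/= andbT => /andP[+ _].
  by apply: lt_le_trans; rewrite invr_gt0.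
have US : \bigcup_n S n = `]0%R, +oo[%classic.
  apply/seteqP; split => [y [n _ /S_pos]//|y]; rewrite /= in_itv/= andbT => y0.
  exists (maxn (Num.truncn y^-1) (Num.truncn y)) => //.
  rewrite /S/= in_itv/=; apply/andP; split.
    rewrite invf_ple ?posrE//.
    apply: le_trans (ltW (truncnS_gt y^-1)) _.
    by rewrite ler_nat ltnS leq_maxl.
  apply: le_trans (ltW (truncnS_gt y)) _.
  by rewrite ler_nat !ltnS leqW// leq_maxr.
have S_nd : nondecreasing_seq S.
  move=> m n mn; apply/subsetPset => y; rewrite /S/= !in_itv/= => /andP[? ?].
  apply/andP; split.
    by apply: le_trans; last eassumption; rewrite lef_pV2 ?posrE// ler_nat ltnS.
  by apply: le_trans; first eassumption; rewrite ler_nat !ltnS.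
have lim : (\int[mu]_(y in S n) ((P y * f y) ^+ 2)%:E)%E @[n --> \oo] -->
    (\int[mu]_(y in `]0%R, +oo[) ((P y * f y) ^+ 2)%:E)%E.
  rewrite -US; apply: ge0_nondecreasing_set_cvg_integral => //.
  - by move=> n; exact: measurable_itv.
  - move=> n.
    exact: (measurable_funS (measurable_itv _) (@S_pos n) (meas _ cvgp)).
  - by move=> n y _; rewrite lee_fin sqr_ge0.
apply/lee_addgt0Pr => e e0; apply: (cvge_to_le lim).
have fn0 : f (n.+1%:R^-1) ^+ 2 @[n --> \oo] --> (0 : R).
  have fn : f n.+1%:R^-1 @[n --> \oo] --> (0 : R).
    move/cvg_at_rightP : f0; apply; split; last exact: cvg_harmonic.
    by move=> n; rewrite invr_gt0.
  by rewrite -[X in _ --> X](mulr0 (0 : R)); exact: cvgM.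
near=> n.
apply: le_trans (segment _ _) _.
- by rewrite invr_gt0.
- by rewrite (@le_lt_trans _ _ 1)// ?ltr1n// invf_le1 ?ler1n.
rewrite addeC leeD//.
  apply: ge0_subset_integral => //; first exact: (meas _ cvgq).
    by move=> y _; rewrite lee_fin sqr_ge0.
  exact: S_pos.
rewrite lee_fin ltW//; near: n.
exact: (cvgr_lt 0).
Unshelve. all: by end_near.
Qed.

End Weights.
End Hardy.

Section Slices.
Context {R : realType}.

Lemma is_derive_section (f : R * R -> R) (x y d : R) :
  is_derive (x, y) e_y f d -> is_derive y 1 (fun y => f (x, y)) d.
Proof.
have E : (fun h : R => h^-1 *: (f (h *: e_y + (x, y)) - f (x, y))) =
    (fun h : R => h^-1 *: (f (x, h *: (1 : R) + y) - f (x, y))).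
  apply/funext => h; congr (_ *: (f _ - _)).
  by rewrite /e_y; congr (_, _); rewrite /= scaler0 add0r.
case; rewrite /derivable /derive => df dE; split.
  by rewrite /derivable; move: df; rewrite E.
by rewrite /derive -dE E.
Qed.

Lemma ae_itv_ge0 (T t : R) (phi : R -> R) : 0 < T -> 0 <= t <= T ->
  phi s @[s --> within [set s | 0 <= s <= T] (nbhs t)] --> phi t ->
  {ae @lebesgue_measure R, forall s, 0 <= s <= T -> 0 <= phi s} ->
  0 <= phi t.
Proof.
move=> T0 /andP[t0 tT] cphi [N [mN N0 phiN]].
rewrite leNgt; apply/negP => phit.
have /= : \forall s \near within [set s | 0 <= s <= T] (nbhs t), phi s < 0.
  exact: cvgr_lt cphi _ phit.
rewrite /within /= => /nbhs_ballP[e /= e0 te].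
pose a := Num.max 0 (t - e); pose b := Num.min T (t + e).
have ab : a < b.
  by rewrite lt_min !gt_max; apply/andP; split; apply/andP; split; lra.
have : (lebesgue_measure (`]a, b[%classic : set R) <= lebesgue_measure N)%E.
  apply: le_measure; rewrite ?inE//.
  move=> s; rewrite /= in_itv/= /a /b lt_min gt_max.
  move=> /andP[/andP[s0 ts] /andP[sT st]].
  apply: phiN => /= /(_ (ltac:(apply/andP; split; lra) : 0 <= s <= T)).
  apply/negP; rewrite -ltNge; apply: te; last by apply/andP; split; lra.
  by rewrite /ball/= ltr_distlC; apply/andP; split; lra.
by rewrite N0 lebesgue_measure_itv/= lte_fin ab -EFinD lee_fin; lra.
Qed.

Lemma continuous_on_slice (A : set (R * (R * R))) (w : R -> R * R -> R) t z :
  continuous_on A w -> A (t, z) -> (\forall z' \near z, A (t, z')) ->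
  {for z, continuous (w t)}.
Proof.
move=> cw Atz nA.
apply: (within_cvg_comp (h := fun z' => (t, z')) cw Atz _ nA).
exact: (cvg_pair (cvg_cst t) cvg_id).
Qed.

Lemma near_half_plane (z : R * R) : 0 < z.2 -> \forall z' \near z, 0 < z'.2.
Proof. by move=> z0; apply: open_nbhs_nbhs; split => //; exact: half_plane_open. Qed.

End Slices.

Section WeightedHardy.
Context {R : realType}.
Variables (sigma delta : R) (w w' q q' : R * R -> R).
Hypothesis sigma_ge : 2^-1 <= sigma.
Hypothesis delta_gt0 : 0 < delta.
Hypothesis dw : forall z : R * R, 0 < z.2 -> is_derive z e_y w (w' z).
Hypothesis dq : forall z : R * R, 0 < z.2 -> is_derive z e_y q (q' z).
Hypothesis cw : forall z : R * R, 0 < z.2 -> {for z, continuous w}.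
Hypothesis cw' : forall z : R * R, 0 < z.2 -> {for z, continuous w'}.
Hypothesis cq : forall z : R * R, 0 < z.2 -> {for z, continuous q}.
Hypothesis cq' : forall z : R * R, 0 < z.2 -> {for z, continuous q'}.
Hypothesis q_ge : forall z : R * R, 0 < z.2 -> delta <= weight sigma z * q z.
Hypothesis q_le : forall z : R * R, 0 < z.2 -> `|weight sigma z * q z| <= delta^-1.
Hypothesis q'_le : forall z : R * R, 0 < z.2 ->
  `|weight (sigma + 1) z * q' z| <= delta^-1.
Hypothesis w_wall : forall x, w (x, y) @[y --> 0^'+] --> 0.

Let g z := w' z - q' z / q z * w z.

Let weight_gt0 (r : R) (z : R * R) : 0 < z.2 -> 0 < weight r z.
Proof. by move=> z0; rewrite powR_gt0//; lra. Qed.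

Let q_gt0 (z : R * R) : 0 < z.2 -> 0 < q z.
Proof.
move=> z0; have := lt_le_trans delta_gt0 (q_ge z0).
by rewrite pmulr_rgt0// weight_gt0.
Qed.

Let ratio_ge (z : R * R) : 0 < z.2 ->
  1 <= delta^-1 * ((weight sigma z)^-1 / q z).
Proof.
move=> z0; have W0 := weight_gt0 sigma z0; have qz := q_gt0 z0.
rewrite -invfM ler_pdivlMr ?mulr_gt0// mul1r.
exact: le_trans (ler_norm _) (q_le z0).
Qed.

Let ratio_le (z : R * R) : 0 < z.2 -> (weight sigma z)^-1 / q z <= delta^-1.
Proof.
move=> z0; have W0 := weight_gt0 sigma z0; have qz := q_gt0 z0.
by rewrite -invfM lef_pV2 ?posrE ?mulr_gt0// q_ge.
Qed.

Let weightS (z : R * R) : 0 < z.2 ->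
  weight (sigma + 1) z = weight sigma z * (1 + z.2).
Proof.
move=> z0; have m0 : 0 < 1 + z.2 by lra.
by rewrite /weight powRD ?(gt_eqF m0) ?implybT// powRr1// ltW.
Qed.

Lemma is_derive_quotient (z : R * R) : 0 < z.2 ->
  is_derive z e_y (fun z : R * R => w z / q z) (g z / q z).
Proof.
move=> z0; have q0 : q z != 0 by rewrite gt_eqF// q_gt0.
have [dqz q'E] := dq z0; have dw0 := dw z0.
have dV : is_derive z e_y (fun z => (q z)^-1) (- (q z) ^- 2 * q' z).
  by split; [exact: derivableV|rewrite deriveV// q'E].
have dM := is_deriveM dw0 dV.
have -> : (fun z : R * R => w z / q z) = w * (fun z => (q z)^-1) by [].
apply: is_derive_eq.
by rewrite /g /GRing.scale/=; field.
Qed.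

Lemma weighted_difference_eq (z : R * R) : 0 < z.2 ->
  g z = q z * dy (fun z : R * R => w z / q z) z.
Proof.
move=> z0; have [_ dE] := is_derive_quotient z0.
by rewrite /dy dE mulrC divfK// gt_eqF// q_gt0.
Qed.

Let cont_g (z : R * R) : 0 < z.2 -> {for z, continuous g}.
Proof.
move=> z0; apply: cvgB; first exact: cw'.
apply: cvgM; last exact: cw.
apply: cvgM; first exact: cq'.
by apply: cvgV; [rewrite gt_eqF// q_gt0|exact: cq].
Qed.

Let measurable_cont (h : R * R -> R) :
  (forall z : R * R, 0 < z.2 -> {for z, continuous h}) ->
  @measurable_fun _ _ (R * R)%type R Omega h.
Proof.
move=> ch; apply: (@measurable_funS _ _ _ _ [set z : R * R | 0 < z.2]).
- by apply: open_measurable_prod; exact: half_plane_open.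
- by move=> z [].
- apply: open_continuous_measurable_prod; first exact: half_plane_open.
  by move=> z; rewrite inE; exact: ch.
Qed.

Let cont_u (z : R * R) : 0 < z.2 ->
  {for z, continuous (fun z : R * R => w z / (1 + z.2))}.
Proof.
move=> z0; apply: cvgM; first exact: cw.
apply: cvgV; first by rewrite gt_eqF//; lra.
by apply: cvgD; [exact: cvg_cst|exact: cvg_snd].
Qed.

Let cont_section (h : R * R -> R) x y : {for (x, y), continuous h} ->
  {for y, continuous (fun y : R => h (x, y))}.
Proof.
move=> ch; have cx : (x, s) @[s --> y] --> (x, y).
  exact: (cvg_pair (cvg_cst x) cvg_id).
exact: (cvg_comp _ _ cx ch).
Qed.

Lemma L2norm_weighted_hardy :
  (L2norm (fun z : R * R => w z / (1 + z.2))%R <= (delta ^- 2)%:E * L2norm g)%E.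
Proof.
have d0 := delta_gt0.
apply: L2norm_le_sections.
- by rewrite invr_ge0 sqr_ge0.
- exact: measurable_cont cont_u.
- exact: measurable_cont cont_g.
move=> x /=.
pose f y := w (x, y) / q (x, y); pose f' y := g (x, y) / q (x, y).
have cq_x (y : R) : 0 < y -> {for y, continuous (fun y : R => q (x, y))}.
  by move=> y0; exact: (cont_section (@cq (x, y) y0)).
have cg_x (y : R) : 0 < y -> {for y, continuous (fun y : R => g (x, y))}.
  by move=> y0; exact: (cont_section (@cont_g (x, y) y0)).
have q0 (y : R) : 0 < y -> 0 < q (x, y) by move=> y0; exact: (@q_gt0 (x, y)).
have df (y : R) : 0 < y -> is_derive y 1 f (f' y).
  by move=> y0; exact: (is_derive_section (@is_derive_quotient (x, y) y0)).
have cf' y : 0 < y -> {for y, continuous f'}.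
  move=> y0; apply: cvgM; first exact: cg_x.
  by apply: cvgV; [rewrite gt_eqF// q0|exact: cq_x].
have f_wall : f y @[y --> 0^'+] --> 0.
  apply/norm_cvg0P.
  apply: (@squeeze_cvgr _ _ _ _ (fun=> 0)
    (fun y => delta^-1 * 2 `^ sigma * `|w (x, y)|)); last 2 first.
  - exact: cvg_cst.
  - rewrite -[X in _ --> X](mulr0 (delta^-1 * 2 `^ sigma)).
    by apply: cvgM; [exact: cvg_cst|apply/norm_cvg0P; exact: w_wall].
  near=> y; rewrite normr_ge0/= /f normrM normfV mulrC ler_wpM2r//.
  have y0 : 0 < y by near: y; exact: nbhs_right_gt.
  have y1 : y < 1 by near: y; exact: nbhs_right_lt.
  have W0 := @weight_gt0 sigma (x, y) y0.
  rewrite gtr0_norm ?q0//.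
  have := @ratio_le (x, y) y0; rewrite mulrC ler_pdivrMr// => /le_trans; apply.
  apply: ler_wpM2l; first by rewrite invr_ge0 ltW.
  by apply: ge0_ler_powR; rewrite ?nnegrE/=; move: sigma_ge; lra.
have PE (y : R) : 0 < y -> (1 + y) `^ (- (sigma + 1)) =
    (weight sigma (x, y))^-1 * (1 + y)^-1.
  by move=> y0; rewrite powRN -invfM -(@weightS (x, y)).
have meas (h : R -> R) : (forall y : R, 0 < y -> {for y, continuous h}) ->
    measurable_fun (`]0%R, +oo[%classic : set R) (fun y => (h y ^+ 2)%:E).
  move=> ch; apply/measurable_EFinP; apply: measurable_funX.
  apply: open_continuous_measurable_fun; first exact: interval_open.
  by move=> y; rewrite inE/= in_itv/= andbT => y0; exact: ch.
have cP (r y : R) : 0 < y -> {for y, continuous (fun y : R => (1 + y) `^ r)}.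
  by move=> y0; exact: is_derive1_continuous (is_derive_powR_add1 _ y0).
have cf (y : R) : 0 < y -> {for y, continuous f}.
  by move=> /df; exact: is_derive1_continuous.
have scale (c : R) (h k : R -> R) :
    (forall y : R, 0 < y -> {for y, continuous h}) ->
    (forall y : R, 0 < y -> {for y, continuous k}) ->
    (forall y : R, 0 < y -> h y ^+ 2 <= c ^+ 2 * k y ^+ 2) ->
    (\int[lebesgue_measure]_(y in `]0%R, +oo[) (h y ^+ 2)%:E <=
     (c ^+ 2)%:E * \int[lebesgue_measure]_(y in `]0%R, +oo[) (k y ^+ 2)%:E)%E.
  move=> ch ck hk; rewrite -ge0_integralZl_EFin ?sqr_ge0//; last 2 first.
  - by move=> y _; rewrite lee_fin sqr_ge0.
  - exact: meas.
  apply: ge0_le_integral => //.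
  - by move=> y _; rewrite lee_fin sqr_ge0.
  - exact: meas.
  - by apply: measurable_funeM; exact: meas.
  move=> y; rewrite /= in_itv/= andbT => y0.
  by rewrite -EFinM lee_fin hk.
have EFinX4 : ((delta ^- 2) ^+ 2)%:E = ((delta^-1 ^+ 2)%:E * (delta^-1 ^+ 2)%:E)%E.
  by rewrite -EFinM; congr (_%:E); rewrite -exprVn; ring.
rewrite EFinX4 -muleA.
have sqr_le (a b : R) : `|a| <= delta^-1 * `|b| -> a ^+ 2 <= delta^-1 ^+ 2 * b ^+ 2.
  move=> ab; rewrite -[leLHS]real_normK ?num_real// -[b ^+ 2]real_normK ?num_real//.
  by rewrite -exprMn lerXn2r ?nnegrE// mulr_ge0// invr_ge0 ltW.
apply: (@le_trans _ _ ((delta^-1 ^+ 2)%:E * \int[lebesgue_measure]_(y in `]0%R, +oo[)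
    (((1 + y) `^ (- (sigma + 1)) * f y) ^+ 2)%:E)%E).
  apply: (scale _ (fun y => w (x, y) / (1 + y))) => y y0.
  - exact: (cont_section (@cont_u (x, y) y0)).
  - by apply: cvgM; [exact: cP|exact: cf].
  apply: sqr_le; rewrite PE// /f !normrM !normfV.
  have m0 : 0 < 1 + y by lra.
  rewrite (gtr0_norm m0) (gtr0_norm (q0 _ y0)).
  rewrite (gtr0_norm (@weight_gt0 sigma (x, y) y0)).
  rewrite -[leLHS]mul1r.
  have -> : delta^-1 * ((weight sigma (x, y))^-1 * (1 + y)^-1 *
      (`|w (x, y)| / q (x, y))) =
    delta^-1 * ((weight sigma (x, y))^-1 / q (x, y)) * (`|w (x, y)| / (1 + y)).
    by ring.
  apply: ler_wpM2r; last exact: ratio_ge.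
  by rewrite mulr_ge0 ?invr_ge0// ltW.
apply: lee_wpmul2l; first by rewrite lee_fin sqr_ge0.
apply: le_trans (hardy sigma_ge df cf' f_wall) _.
apply: (scale _ _ (fun y => g (x, y))) => y y0.
- by apply: cvgM; [exact: cP|exact: cf'].
- exact: cg_x.
apply: sqr_le; rewrite powRN /f' !normrM !normfV (gtr0_norm (q0 _ y0)).
rewrite (gtr0_norm (@weight_gt0 sigma (x, y) y0)) mulrCA mulrC ler_wpM2r//.
exact: ratio_le.
Unshelve. all: by end_near.
Qed.

Lemma L2norm_derivative_le :
  (L2norm w' <= (1 + delta ^- 4)%:E * L2norm g)%E.
Proof.
have d0 := delta_gt0.
have cont_a (z : R * R) : 0 < z.2 ->
    {for z, continuous (fun z : R * R => q' z / q z * w z)}.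
  move=> z0; apply: cvgM; last exact: cw.
  apply: cvgM; first exact: cq'.
  by apply: cvgV; [rewrite gt_eqF// q_gt0|exact: cq].
have -> : w' = (fun z => g z + q' z / q z * w z).
  by apply/funext => z; rewrite subrK.
apply: le_trans.
  by apply: L2normD; apply: measurable_cont; [exact: cont_g|exact: cont_a].
have d4 : 0 <= delta ^- 4 by rewrite invr_ge0 exprn_ge0// ltW.
rewrite EFinD ge0_muleDl ?lee_fin// mul1e.
apply: leeD2l.
have -> : delta ^- 4 = delta ^- 2 * delta ^- 2 by rewrite -invfM -exprD.
rewrite EFinM -muleA; apply: le_trans; last first.
  apply: lee_wpmul2l; last exact: L2norm_weighted_hardy.
  by rewrite lee_fin invr_ge0 sqr_ge0.
apply: L2norm_le_pointwise.
- by rewrite invr_ge0 sqr_ge0.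
- exact: measurable_cont cont_a.
- exact: measurable_cont cont_u.
move=> z [_ z0].
have m0 : 0 < 1 + z.2 by lra.
have W0 := weight_gt0 sigma z0; have qz := q_gt0 z0.
rewrite !normrM !normfV (gtr0_norm m0) (gtr0_norm qz).
have q'z : `|q' z| <= delta^-1 * ((weight sigma z)^-1 * (1 + z.2)^-1).
  rewrite -invfM -weightS// ler_pdivlMr ?weight_gt0// mulrC.
  by rewrite -(gtr0_norm (weight_gt0 _ z0)) -normrM q'_le.
have -> : delta ^- 2 * (`|w z| / (1 + z.2)) =
    delta^-1 * (delta^-1 * (1 + z.2)^-1) * `|w z|.
  by rewrite expr2 invfM; ring.
apply: ler_wpM2r => //.
apply: (@le_trans _ _ (delta^-1 * ((weight sigma z)^-1 * (1 + z.2)^-1) / q z)).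
  by apply: ler_wpM2r => //; rewrite invr_ge0 ltW.
have -> : delta^-1 * ((weight sigma z)^-1 * (1 + z.2)^-1) / q z =
    delta^-1 * ((weight sigma z)^-1 / q z * (1 + z.2)^-1) by ring.
apply: ler_wpM2l; first by rewrite invr_ge0 ltW.
by apply: ler_wpM2r; [rewrite invr_ge0 ltW|exact: ratio_le].
Qed.

End WeightedHardy.

Section SolutionBounds.
Context {R : realType}.

(* [solution_class] constrains the slices only for almost every time; the
   continuity in time of omega and of its y-derivative extends the pointwise
   bounds to every time. *)
Lemma solution_bounds (T n gamma sigma delta : R) (s : nat) (U p : R -> R -> R)
    (u0 : R * R -> R) (u v : R -> R * R -> R) :
  0 < T -> 0 < delta ->
  classical_solution T n U p u0 u v -> solution_class T s gamma sigma delta U u ->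
  forall t z, 0 <= t <= T -> 0 < z.2 ->
  [/\ delta <= weight sigma z * dy (u t) z,
      `|weight sigma z * dy (u t) z| <= delta^-1 &
      `|weight (sigma + 1) z * dy (dy (u t)) z| <= delta^-1].
Proof.
move=> T0 d0 sol [_ [_ [M cls]]] t z tT z0.
have ae_filter := ae_filter_ringOfSetsType (@lebesgue_measure R).
have [_ cdy cddy _] := sol_continuous_derivatives sol.
have ct (w : R -> R * R -> R) : continuous_on (cyl_off_wall T) w ->
    w s z @[s --> within [set s | 0 <= s <= T] (nbhs t)] --> w t z.
  move=> cw.
  have tzs : (r, z) @[r --> within [set r | 0 <= r <= T] (nbhs t)] --> (t, z).
    exact: (cvg_pair (cvg_within _) (cvg_cst z)).
  apply: (within_cvg_comp (h := fun r => (r, z)) cw _ tzs).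
    by split.
  by apply: filterS (withinT _ _) => r rT; split.
have bound (w : R -> R * R -> R) (b : nat) : (b <= 2)%N ->
    continuous_on (cyl_off_wall T) w ->
    (forall r, Dab 0 b (dy (u r)) = w r) ->
    `|weight (sigma + b%:R) z * w t z| <= delta^-1.
  move=> b2 cw wE.
  suff : 0 <= delta ^- 2 - `|weight (sigma + b%:R) z * w t z| ^+ 2.
    have di0 : 0 <= delta^-1 by rewrite invr_ge0 ltW.
    by rewrite subr_ge0 -exprVn ler_sqr.
  apply: (ae_itv_ge0 (phi := fun r =>
      delta ^- 2 - `|weight (sigma + b%:R) z * w r z| ^+ 2) T0 tT).
    apply: cvgB; first exact: cvg_cst.
    apply: cvgM; apply: cvg_norm; apply: cvgM; by [exact: cvg_cst|exact: ct].
  apply: (@filterS _ _ ae_filter _ _ _ cls) => r + rT.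
  move=> /(_ rT)[[_ _ /(_ _ z0) sumle] _].
  rewrite subr_ge0; apply: le_trans sumle.
  rewrite -wE (bigD1 ord0)//; apply: ler_wpDr.
    by apply: sumr_ge0 => i _; apply: sumr_ge0 => j _; exact: exprn_ge0.
  rewrite (bigD1 (Ordinal (b2 : (b < 3)%N)))//; apply: ler_wpDr => //.
  by apply: sumr_ge0 => j _; exact: exprn_ge0.
split.
- rewrite -subr_ge0.
  apply: (ae_itv_ge0 (phi := fun r => weight sigma z * dy (u r) z - delta) T0 tT).
    apply: cvgB; last exact: cvg_cst.
    by apply: cvgM; [exact: cvg_cst|exact: (ct (fun r => dy (u r)) cdy)].
  apply: (@filterS _ _ ae_filter _ _ _ cls) => r + rT.
  move=> /(_ rT)[[_ + _] _] => /(_ _ z0).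
  by rewrite subr_ge0.
- by have := bound (fun r => dy (u r)) 0%N isT cdy (fun=> erefl); rewrite addr0.
- exact: (bound (fun r => dy (dy (u r))) 1%N isT cddy (fun=> erefl)).
Qed.

End SolutionBounds.

Theorem lemma4p1 (R : realType) (sigma delta : R) (hdelta : 0 < delta < 1 / 2) :
  exists C : R, 0 < C /\
    forall (n gamma : R) (s : nat) (T : R) (U p : R -> R -> R)
           (u0 : R * R -> R) (u1 v1 u2 v2 : R -> R * R -> R),
      1 < n < 7 / 3 -> (6 <= s)%N -> ~~ odd s -> 1 <= gamma ->
      gamma + 1 / 2 < sigma ->
      sigma <= Num.min (2 / (n - 1)) (gamma + 4 / 3) ->
      0 < T ->
      outer_flow T U p ->
      classical_solution T n U p u0 u1 v1 ->
      classical_solution T n U p u0 u2 v2 ->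
      solution_class T s gamma sigma delta U u1 ->
      solution_class T s gamma sigma delta U u2 ->
      forall t : R, 0 <= t <= T ->
        let omega1 := dy (u1 t) in
        let omega2 := dy (u2 t) in
        let ubar := fun z => u1 t z - u2 t z in
        let omegabar := fun z => omega1 z - omega2 z in
        let a2 := fun z => dy omega2 z / omega2 z in
        let gbar := fun z => omegabar z - a2 z * ubar z in
        (forall z, 0 < z.2 ->
           gbar z = omega2 z * dy (fun z' => ubar z' / omega2 z') z) /\
        (L2norm (fun z => ubar z / (1 + z.2))%R + L2norm omegabar
           <= C%:E * L2norm gbar)%E.
Proof.
have /andP[d0 _] := hdelta.
have d2 : 0 < delta ^- 2 by rewrite invr_gt0 exprn_gt0.
have d4 : 0 < delta ^- 4 by rewrite invr_gt0 exprn_gt0.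
exists (delta ^- 2 + (1 + delta ^- 4)); split; first by rewrite !addr_gt0.
move=> n gamma s T U p u0 u1 v1 u2 v2 _ _ _ gamma1 gs _ T0 _ sol1 sol2 _ cls2.
move=> t tT omega1 omega2 ubar omegabar a2 gbar.
have sigma_ge : 2^-1 <= sigma by lra.
have bounds := solution_bounds T0 d0 sol2 cls2.
have off_wall (w : R -> R * R -> R) : continuous_on (cyl_off_wall T) w ->
    forall z : R * R, 0 < z.2 -> {for z, continuous (w t)}.
  move=> cw z z0; apply: (continuous_on_slice cw); first by split.
  by apply: filterS (near_half_plane z0) => z' z'0; split.
have [cu1 _] := sol_continuous sol1; have [cu2 _] := sol_continuous sol2.
have cyl_sub w : continuous_on (closed_cyl T) w -> continuous_on (cyl_off_wall T) w.
  by apply: continuous_subspaceW => q [q1 /ltW q2]; split.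
have [_ cdy1 _ _] := sol_continuous_derivatives sol1.
have [_ cdy2 cddy2 _] := sol_continuous_derivatives sol2.
have c_ubar (z : R * R) : 0 < z.2 -> {for z, continuous ubar}.
  by move=> z0; apply: cvgB; apply: off_wall => //; exact: cyl_sub.
have c_omegabar (z : R * R) : 0 < z.2 -> {for z, continuous omegabar}.
  by move=> z0; apply: cvgB; [exact: (off_wall _ cdy1)|exact: (off_wall _ cdy2)].
have c_omega2 : forall z : R * R, 0 < z.2 -> {for z, continuous omega2}.
  exact: off_wall cdy2.
have c_omega2' : forall z : R * R, 0 < z.2 -> {for z, continuous (dy omega2)}.
  exact: off_wall cddy2.
have d_ubar (z : R * R) : 0 < z.2 -> is_derive z e_y ubar (omegabar z).
  move=> z0; have [_ du1 _ _] := sol_derivable_space sol1 tT z0.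
  have [_ du2 _ _] := sol_derivable_space sol2 tT z0.
  by apply: is_deriveB; split.
have d_omega2 (z : R * R) : 0 < z.2 -> is_derive z e_y omega2 (dy omega2 z).
  by move=> z0; have [_ _ ddu2 _] := sol_derivable_space sol2 tT z0; split.
have omega2_ge (z : R * R) : 0 < z.2 -> delta <= weight sigma z * omega2 z.
  by move=> z0; have [] := bounds t z tT z0.
have omega2_le (z : R * R) : 0 < z.2 -> `|weight sigma z * omega2 z| <= delta^-1.
  by move=> z0; have [] := bounds t z tT z0.
have omega2'_le (z : R * R) : 0 < z.2 ->
    `|weight (sigma + 1) z * dy omega2 z| <= delta^-1.
  by move=> z0; have [] := bounds t z tT z0.
have wall x : ubar (x, y) @[y --> 0^'+] --> 0.
  have wall_u (u : R -> R * R -> R) : continuous_on (closed_cyl T) u ->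
      u t (x, y) @[y --> 0^'+] --> u t (x, 0).
    move=> cu; have cvg_wall : (t, (x, y)) @[y --> 0^'+] --> (t, (x, 0 : R)).
      exact: (cvg_pair (cvg_cst t) (cvg_pair (cvg_cst x) (cvg_within _))).
    apply: (within_cvg_comp (h := fun y => (t, (x, y))) cu _ cvg_wall).
    - by split => /=.
    - near=> y; have y0 : 0 < y by near: y; exact: nbhs_right_gt.
      by split => //=; exact: ltW.
  have [u1x _] := sol_wall sol1 x tT; have [u2x _] := sol_wall sol2 x tT.
  have ubar0 : ubar (x, 0) = 0 by rewrite /ubar u1x u2x subrr.
  rewrite -[X in _ --> X]ubar0.
  exact: (cvgB (wall_u u1 cu1) (wall_u u2 cu2)).
split=> [z z0|].
  exact: (weighted_difference_eq d0 d_ubar d_omega2 omega2_ge z0).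
rewrite EFinD ge0_muleDl ?lee_fin//; last 2 first.
- exact: ltW.
- by rewrite addr_ge0// ltW.
apply: leeD.
  exact: (L2norm_weighted_hardy sigma_ge d0 d_ubar d_omega2 c_ubar c_omegabar
    c_omega2 c_omega2' omega2_ge omega2_le wall).
exact: (L2norm_derivative_le sigma_ge d0 d_ubar d_omega2 c_ubar c_omegabar
    c_omega2 c_omega2' omega2_ge omega2_le omega2'_le wall).
Unshelve. all: by end_near.
Qed.
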